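(* Let $h\geq 3$ and $k\geq 3h+1$ be positive integers. Let $A$ be a finite set of $k$ integers such that $\min(A)=0$, $\gcd(A)=1$, and $|h^{\wedge}A| = hk-h^2+2$. Then $A=[0,k]\setminus\{x\}$ for some $x\in\{1,k-1\}$.
   Context: For a finite set $A$ of integers and a positive integer $h\le |A|$, the restricted $h$-fold sumset $h^{\wedge}A$ is the set of all sums of $h$ distinct elements of $A$. For integers $\alpha\le\beta$, $[\alpha,\beta]=\{x\in\mathbb{Z}:\alpha\le x\le\beta\}$. $\gcd(A)$ denotes the greatest common divisor of the elements of $A$. *)

(* Defs.v *)
From mathcomp Require Export all_boot all_order all_algebra.
From mathcomp Require Export finmap.

Set Implicit Arguments.
Unset Strict Implicit.
Unset Printing Implicit Defensive.

Import Order.TTheory GRing.Theory Num.Theory.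
Local Open Scope fset_scope.
Local Open Scope ring_scope.

Definition restricted_sumset (h : nat) (A : {fset int}) : {fset int} :=
  [fset \sum_(x <- B) x | B : {fset int} in [fset B in fpowerset A | #|` B| == h]].

Definition zinterval (a b : int) : {fset int} :=
  [fset a + i%:Z | i in iota 0 (if a <= b then `|b - a|%N.+1 else 0%N)].

Definition set_gcd (A : {fset int}) : int := \big[gcdz/0]_(x <- A) x.

Lemma restricted_sumsetP (h : nat) (A : {fset int}) (s : int) :
  reflect (exists2 B : {fset int}, (B `<=` A) && (#|` B| == h) &
             s = \sum_(x <- B) x)
          (s \in restricted_sumset h A).
Proof.
apply: (iffP (imfsetP _ _ _ _)) => -[B] /=.
  by rewrite !inE /= fpowersetE => hB ->; exists B.
by move=> hB ->; exists B => //=; rewrite !inE /= fpowersetE.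
Qed.

Lemma mem_zinterval (a b x : int) : (x \in zinterval a b) = (a <= x <= b).
Proof.
apply/imfsetP/andP => /= [[i]|[ax xb]].
  rewrite mem_iota add0n; case: ifP => //= ab ib ->; split.
    by rewrite lerDl.
  rewrite -lerBrDl -(gez0_abs (m := b - a)) ?subr_ge0 //.
exists `|x - a|%N; last by rewrite gez0_abs ?subr_ge0 // [RHS]addrC subrK.
rewrite mem_iota add0n (le_trans ax xb) /= ltnS -lez_nat.
by rewrite !gez0_abs ?subr_ge0 ?(le_trans ax xb) // lerD2r.
Qed.

Lemma dvdz_set_gcd (A : {fset int}) (d : int) :
  (d %| set_gcd A)%Z = all (fun x => (d %| x)%Z) A.
Proof.
rewrite /set_gcd; elim: (enum_fset A) => [|x s IHs].
  by rewrite big_nil dvdz0.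
by rewrite big_cons dvdz_gcd IHs.
Qed.

(* Main.v *)
(* Enumerate A as a_0 < ... < a_(k-1) and encode a sum of h distinct elements
   by its set B of indices.  Let the excess of B be the number of elements of
   h^A below the sum of B, minus the sum of the indices in B.  Replacing an
   index by a larger one does not decrease the excess, so the excess of B lies
   between those of the first h and of the last h indices; by the cardinality
   hypothesis it takes at most two consecutive values, low and low + 1.

   Write d_i = a_(i+1) - a_i.  If d_p < d_q with p and q not adjacent, then
   {p+1, q} + D and {p, q+1} + D have the same index sum, hence excess low and
   low + 1 for every D.  Comparing such sets for various D forces the inner
   gaps to share a value c and the extreme gaps to be at least c, not both
   larger, and a larger one to be 2c.  Not all gaps are c, since otherwise h^A
   would have at most h(k-h)+1 elements, and c = 1 because gcd(A) = 1. *)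
Require Import Defs.
From mathcomp Require Import zify ring lra.

Set Implicit Arguments.
Unset Strict Implicit.
Unset Printing Implicit Defensive.

Import Order.TTheory GRing.Theory Num.Theory.
Local Open Scope fset_scope.
Local Open Scope ring_scope.

(** * Index sets, their sums and their excess *)

(** Sets are encoded as duplicate-free lists, so that a changed index can be shown at the head of
    the list; the order is immaterial by [perm_index_set] and [perm_excess]. *)
Definition index_set (h k : nat) (B : seq nat) : bool :=
  [&& uniq B, size B == h & all (fun i => i < k)%N B].

Definition nth_sum (a : nat -> int) (B : seq nat) : int := \sum_(i <- B) a i.

Definition below (S : {fset int}) (x : int) : nat := #|` [fset y in S | y < x]|.

Definition excess (a : nat -> int) (S : {fset int}) (B : seq nat) : int :=
  (below S (nth_sum a B))%:Z - (sumn B)%:Z.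

Lemma nth_sum_cons a i B : nth_sum a (i :: B) = a i + nth_sum a B.
Proof. by rewrite /nth_sum big_cons. Qed.

Lemma perm_index_set h k B B' :
  perm_eq B B' -> index_set h k B = index_set h k B'.
Proof.
move=> pB; rewrite /index_set (perm_uniq pB) (perm_size pB).
by rewrite (perm_all _ pB).
Qed.

Lemma perm_excess a S B B' : perm_eq B B' -> excess a S B = excess a S B'.
Proof.
by move=> pB; rewrite /excess /nth_sum (perm_big _ pB) /= (perm_sumn pB).
Qed.

Lemma fproper_witness (X Y : {fset int}) (x : int) :
  X `<=` Y -> x \in Y -> x \notin X -> X `<` Y.
Proof.
move=> XY xY xX; rewrite fproperE XY /=.
by apply: contra xX => /fsubsetP; apply.
Qed.

Lemma below_ltn (S : {fset int}) (x y : int) :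
  x \in S -> x < y -> (below S x < below S y)%N.
Proof.
move=> xS xy; apply: fproper_ltn_card; apply: (@fproper_witness _ _ x).
- by apply/fsubsetP => z; rewrite !inE => /andP[-> /= /lt_trans]; apply.
- by rewrite !inE xS.
- by rewrite !inE ltxx andbF.
Qed.

Lemma below_inj (S : {fset int}) :
  {in S &, injective (below S)}.
Proof.
move=> x y xS yS e; case: (ltgtP x y) => // xy.
  by have := below_ltn xS xy; rewrite e ltnn.
by have := below_ltn yS xy; rewrite e ltnn.
Qed.

Lemma below_card (S : {fset int}) (x : int) :
  x \in S -> (below S x < #|` S|)%N.
Proof.
move=> xS; apply: fproper_ltn_card; apply: (@fproper_witness _ _ x) => //.
  by apply/fsubsetP => z; rewrite !inE => /andP[].
by rewrite !inE ltxx andbF.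
Qed.

(** * Comparing index sets by exchanging one index at a time *)

Section Exchange.

Variables (h k : nat) (f : seq nat -> int).

Hypothesis perm_f : forall B B', perm_eq B B' -> f B = f B'.

Hypothesis exchange_f : forall i j B, (i < j)%N ->
  index_set h k (i :: B) -> index_set h k (j :: B) -> f (i :: B) <= f (j :: B).

(** Induction on the number of indices of [B] outside [B']. Swapping such an [i] for some [j] in
    [B'] outside [B] goes upwards, so [f] does not decrease, and the number drops by one. *)
Lemma exchange_le B B' : index_set h k B -> index_set h k B' ->
  (forall i j, i \in B -> i \notin B' -> j \in B' -> j \notin B -> (i < j)%N) ->
  f B <= f B'.
Proof.
move=> + vB'; have [n] := ubnP (count (predC (mem B')) B).
elim: n B => // n IH B /ltnSE-le_n vB ltBB'.
have [uB /eqP sB kB] := and3P vB; have [uB' /eqP sB' kB'] := and3P vB'.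
case: (altP (@allP _ (mem B') B)) => [sub|/allPn[i iB iB']].
  rewrite (@perm_f B B') //; apply: uniq_perm => //.
  by case: (uniq_min_size uB sub); rewrite ?sB ?sB'.
(* Such a [j] exists: both lists have [h] entries, so an inclusion of [B'] in [B] would be an
   equality, against the choice of [i]. *)
case: (altP (@allP _ (mem B) B')) => [sub|/allPn[j jB' jB]].
  have [|_ eqB] := uniq_min_size uB' sub; first by rewrite sB sB'.
  by rewrite /= eqB iB in iB'.
have pB := perm_to_rem iB.
have vj : index_set h k (j :: rem i B).
  rewrite /index_set /= (rem_uniq _ uB) andbT (allP kB' _ jB') /=.
  rewrite (contra (@mem_rem _ _ _ _)) //= -sB (perm_size pB) /= eqxx /=.
  by apply/allP => x /mem_rem /(allP kB).
have vi : index_set h k (i :: rem i B) by rewrite -(perm_index_set _ _ pB).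
have ij := ltBB' i j iB iB' jB' jB.
rewrite (perm_f pB); apply: le_trans (exchange_f ij vi vj) _.
apply: IH vj _.
  apply: leq_trans le_n; rewrite (permP pB) /= iB' jB'.
  by rewrite add0n add1n.
move=> x y; rewrite !inE => /orP[/eqP->|]; first by rewrite jB'.
move=> /mem_rem xB xB' yB' /norP[yj yB]; apply: ltBB' => //.
apply: contra yB; rewrite mem_rem_uniq // !inE => ->; rewrite andbT.
by apply: contraNneq iB' => <-.
Qed.

Lemma exchange_min B : (h <= k)%N -> index_set h k B -> f (iota 0 h) <= f B.
Proof.
move=> hk vB; apply: exchange_le => //.
  rewrite /index_set iota_uniq size_iota eqxx /=.
  by apply/allP => i; rewrite mem_iota; lia.
by move=> i j; rewrite !mem_iota; lia.
Qed.

Lemma exchange_max B : (h <= k)%N -> index_set h k B ->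
  f B <= f (iota (k - h) h).
Proof.
move=> hk vB; apply: exchange_le => //.
  rewrite /index_set iota_uniq size_iota eqxx /=.
  by apply/allP => i; rewrite mem_iota; lia.
case/and3P: vB => _ _ /allP kB i j /kB; rewrite !mem_iota => ik.
by move=> + + /negP; lia.
Qed.

End Exchange.

Lemma sumn_iotaDl m n : sumn (iota m n) = (m * n + sumn (iota 0 n))%N.
Proof.
elim: n m => [|n IH] m /=; first by rewrite muln0.
by rewrite IH (IH 1%N); lia.
Qed.

(** The index sum is itself monotone under exchanges, so its extremes are at the first and the last
    [h] indices. *)
Lemma sumn_bounds h k B : (h <= k)%N -> index_set h k B ->
  (sumn (iota 0 h) <= sumn B <= sumn (iota 0 h) + h * (k - h))%N.
Proof.
move=> hk vB.
have pf B1 B2 : perm_eq B1 B2 -> (sumn B1)%:Z = (sumn B2)%:Z.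
  by move=> /perm_sumn->.
have ef i j C : (i < j)%N -> index_set h k (i :: C) ->
    index_set h k (j :: C) -> (sumn (i :: C))%:Z <= (sumn (j :: C))%:Z.
  by move=> ij _ _ /=; lia.
have := exchange_min pf ef hk vB; have := exchange_max pf ef hk vB.
rewrite (sumn_iotaDl (k - h)); lia.
Qed.

(** * Monotonicity and range of the excess *)

Section Excess.

Variables (h k : nat) (a : nat -> int) (S : {fset int}).

Hypothesis a_lt : forall i j, (i < j < k)%N -> a i < a j.

Hypothesis sum_in : forall B, index_set h k B -> nth_sum a B \in S.

(** Raising an index by one adds one to the index sum and at least one to the number of elements of
    [S] below. Longer moves follow by induction on [j - i], passing through [i.+1]. *)
Lemma excess_exchange i j B : (i < j)%N ->
  index_set h k (i :: B) -> index_set h k (j :: B) ->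
  excess a S (i :: B) <= excess a S (j :: B).
Proof.
have [n] := ubnP (j - i)%N; elim: n i j B => // n IH i j B /ltnSE-ijn ij vi vj.
case/and3P: (vi) => /= /andP[iB uB] sB /andP[ik kB].
case/and3P: (vj) => /= /andP[jB _] _ /andP[jk _].
have step m C : index_set h k (m :: C) -> index_set h k (m.+1 :: C) ->
    excess a S (m :: C) <= excess a S (m.+1 :: C).
  move=> v v'; have mk: (m < m.+1 < k)%N.
    by case/and3P: v' => _ _ /= /andP[]; lia.
  have := below_ltn (y := nth_sum a (m.+1 :: C)) (sum_in v).
  rewrite !nth_sum_cons ltrD2r => /(_ (a_lt mk)).
  rewrite /excess !nth_sum_cons /=; lia.
have [ej|Nej] := eqVneq j i.+1; first by rewrite ej in vj *; apply: step.
have swap x y C : excess a S [:: x, y & C] = excess a S [:: y, x & C].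
  by apply: perm_excess; rewrite -(cat1s x) -(cat1s y) perm_catCA.
have i1j : (i.+1 < j)%N by rewrite ltn_neqAle eq_sym Nej.
have ij1n : (j - i.+1 < n)%N by clear -i1j ijn; lia.
have ji : j != i by rewrite neq_ltn ij orbT.
have i1i : i.+1 != i by rewrite neq_ltn ltnSn orbT.
have [iB1|iB1] := boolP (i.+1 \in B); last first.
  have v1 : index_set h k (i.+1 :: B).
    by rewrite /index_set /= iB1 uB sB kB !andbT /= (leq_trans i1j (ltnW jk)).
  apply: le_trans (step _ _ vi v1) _; exact: IH.
have pB := perm_to_rem iB1; set C := rem i.+1 B in pB.
have pBx x : perm_eq (x :: B) [:: x, i.+1 & C] by rewrite perm_cons.
rewrite (perm_excess _ _ (pBx i)) (perm_excess _ _ (pBx j)).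
rewrite (perm_index_set _ _ (pBx i)) in vi.
rewrite (perm_index_set _ _ (pBx j)) in vj.
have valid2 x y : index_set h k [:: x, y & C] =
    [&& x != y, x \notin C, y \notin C, uniq C, (size C).+2 == h,
      (x < k)%N, (y < k)%N & all (fun i => i < k)%N C].
  by rewrite /index_set /= !inE negb_or -!andbA.
rewrite !valid2 in vi vj.
have /and5P[_ iC i1C uC /and4P[sC _ i1k kC]] := vi.
have /and3P[_ jC _] := vj.
have vij : index_set h k [:: j, i & C].
  by rewrite valid2 jC iC uC sC jk ik kC ji.
have vi1i : index_set h k [:: i.+1, i & C].
  by rewrite valid2 i1C iC uC sC i1k ik kC i1i.
rewrite swap; apply: (@le_trans _ _ (excess a S [:: j, i & C])).
  exact: IH vi1i vij.
rewrite swap [leRHS]swap; apply: step.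
  by rewrite valid2 jC iC uC sC jk ik kC eq_sym ji.
by rewrite valid2 jC i1C uC sC jk i1k kC eq_sym Nej.
Qed.

(** At the first [h] indices the count below is at least 0. At the last [h] it is at most h(k-h)+1,
    while the index sum has grown by h(k-h). *)
Lemma excess_bounds B : (h <= k)%N -> (#|` S| <= h * (k - h) + 2)%N ->
  index_set h k B ->
  - (sumn (iota 0 h))%:Z <= excess a S B <= 1 - (sumn (iota 0 h))%:Z.
Proof.
move=> hk cS vB.
have := exchange_min (@perm_excess a S) excess_exchange hk vB.
have := exchange_max (@perm_excess a S) excess_exchange hk vB.
have vt : index_set h k (iota (k - h) h).
  rewrite /index_set iota_uniq size_iota eqxx /=.
  by apply/allP => i; rewrite mem_iota; lia.
have := below_card (sum_in vt).
rewrite /excess (sumn_iotaDl (k - h)); lia.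
Qed.

End Excess.

(** * Common padding, and sums over an arithmetic progression *)

(** One padding [D], disjoint from [L], completes every choice of [n] indices from [L], so that sets
    differing in few indices can be compared. *)
Lemma extend_index_set h k n (L : seq nat) : (n <= h)%N ->
  (size L + h <= k + n)%N ->
  exists D, forall M, size M = n -> uniq M -> all (fun i => i < k)%N M ->
    all (mem L) M -> index_set h k (M ++ D).
Proof.
move=> nh sL; pose F := [seq i <- iota 0 k | i \notin L].
have uF : uniq F by rewrite filter_uniq ?iota_uniq.
have sF : (h - n <= size F)%N.
  have: (k <= size (L ++ F))%N.
    rewrite -[k in (k <= _)%N](size_iota 0); apply: uniq_leq_size => [|x xk].
      exact: iota_uniq.
    by rewrite mem_cat mem_filter xk andbT orbN.
  by rewrite size_cat; move: (size L) (size F) sL => l f; lia.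
exists (take (h - n) F) => M sM uM kM LM.
rewrite /index_set cat_uniq uM take_uniq // size_cat sM size_takel //.
rewrite subnKC // eqxx all_cat kM /= !andbT; apply/andP; split.
  apply/hasPn => x /mem_take; rewrite mem_filter => /andP[xL _].
  by apply: contra xL => /(allP LM).
by apply/allP => x /mem_take; rewrite mem_filter mem_iota => /andP[].
Qed.

Lemma nth_sum_arith (a : nat -> int) (c : int) k B :
  (forall i, (i < k)%N -> a i = a 0%N + c * i%:Z) ->
  all (fun i => i < k)%N B ->
  nth_sum a B = a 0%N * (size B)%:Z + c * (sumn B)%:Z.
Proof.
move=> aE; elim: B => [|i B IH] /= kB.
  by rewrite /nth_sum big_nil !mulr0 addr0.
case/andP: kB => ik /IH {}IH.
by rewrite nth_sum_cons IH aE // PoszD intS; ring.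
Qed.

(** * The gaps between consecutive elements *)

Section Gaps.

Variables (h k : nat) (a : nat -> int) (S : {fset int}).

Hypothesis h_ge3 : (3 <= h)%N.

Hypothesis k_ge : (h + 7 <= k)%N.

Hypothesis a_lt : forall i j, (i < j < k)%N -> a i < a j.

Hypothesis sum_in : forall B, index_set h k B -> nth_sum a B \in S.

Hypothesis in_sum :
  forall x, x \in S -> exists2 B, index_set h k B & x = nth_sum a B.

Hypothesis card_S : #|` S| = (h * (k - h) + 2)%N.

Let gap i := a i.+1 - a i.

Let low := - (sumn (iota 0 h))%:Z.

Let excessS := excess a S.

Lemma excess_low_high B : index_set h k B -> low <= excessS B <= low + 1.
Proof.
rewrite (addrC low); apply: excess_bounds; rewrite ?card_S //.
by clear -k_ge; lia.
Qed.

(** The index sums agree, but the second set has the larger element sum, hence the larger excess;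
    only two values are available. *)
Lemma excess_gap_lt p q D : gap p < gap q ->
  index_set h k [:: p.+1, q & D] -> index_set h k [:: p, q.+1 & D] ->
  excessS [:: p.+1, q & D] = low /\ excessS [:: p, q.+1 & D] = low + 1.
Proof.
move=> pq v1 v2; have := excess_low_high v1; have := excess_low_high v2.
have := @below_ltn S _ (nth_sum a [:: p, q.+1 & D]) (sum_in v1).
have -> : nth_sum a [:: p.+1, q & D] < nth_sum a [:: p, q.+1 & D].
  by move: pq; rewrite /gap !nth_sum_cons; lra.
by move=> /(_ isT); rewrite /excessS /excess /=; lia.
Qed.

Lemma excessS_exchange i j B : (i < j)%N ->
  index_set h k (i :: B) -> index_set h k (j :: B) ->
  excessS (i :: B) <= excessS (j :: B).
Proof. exact: excess_exchange. Qed.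

(* The index sets {p, q+1, c} and {p+1, q, c'} are comparable, whereas
   [gap p < gap q] would give them excesses in the wrong order. *)
Lemma gap_le p q c c' :
  (p.+1 < q)%N || (q.+1 < p < k.-1)%N -> (c < q)%N -> (q.+1 < c' < k)%N ->
  c \notin [:: p; p.+1] -> c' \notin [:: p; p.+1] -> gap q <= gap p.
Proof.
rewrite !inE => pq cq qc cp c'p; rewrite leNgt; apply/negP => gpq.
have [|D vD] := @extend_index_set h k 3 [:: p; p.+1; q; q.+1; c; c'] h_ge3.
  by clear -k_ge; rewrite /=; lia.
have v x y z : uniq [:: x; y; z] -> all (fun i => i < k)%N [:: x; y; z] ->
    all (mem [:: p; p.+1; q; q.+1; c; c']) [:: x; y; z] ->
    index_set h k [:: x, y, z & D] by exact: vD.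
have flip x y z : excessS [:: x, y, z & D] = excessS [:: x, z, y & D].
  by apply: perm_excess; apply/permP => P /=; lia.
have swap x y z : excessS [:: x, y, z & D] = excessS [:: z, x, y & D].
  by apply: perm_excess; apply/permP => P /=; lia.
have vpqc : index_set h k [:: p, q.+1, c & D].
  by apply: v; rewrite /= ?inE ?eqxx ?orbT //; clear -pq cq qc cp c'p; lia.
have vpqc' : index_set h k [:: p.+1, q, c' & D].
  by apply: v; rewrite /= ?inE ?eqxx ?orbT //; clear -pq cq qc cp c'p; lia.
have vqc : index_set h k [:: p.+1, q, c & D].
  by apply: v; rewrite /= ?inE ?eqxx ?orbT //; clear -pq cq qc cp c'p; lia.
have vqc' : index_set h k [:: p, q.+1, c' & D].
  by apply: v; rewrite /= ?inE ?eqxx ?orbT //; clear -pq cq qc cp c'p; lia.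
have v1 : index_set h k [:: c, p, q.+1 & D].
  by apply: v; rewrite /= ?inE ?eqxx ?orbT //; clear -pq cq qc cp c'p; lia.
have v2 : index_set h k [:: q, p, q.+1 & D].
  by apply: v; rewrite /= ?inE ?eqxx ?orbT //; clear -pq cq qc cp c'p; lia.
have v3 : index_set h k [:: q.+1, q, p & D].
  by apply: v; rewrite /= ?inE ?eqxx ?orbT //; clear -pq cq qc cp c'p; lia.
have v4 : index_set h k [:: c', q, p & D].
  by apply: v; rewrite /= ?inE ?eqxx ?orbT //; clear -pq cq qc cp c'p; lia.
have v5 : index_set h k [:: p, c', q & D].
  by apply: v; rewrite /= ?inE ?eqxx ?orbT //; clear -pq cq qc cp c'p; lia.
have v6 : index_set h k [:: p.+1, c', q & D].
  by apply: v; rewrite /= ?inE ?eqxx ?orbT //; clear -pq cq qc cp c'p; lia.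
have [_ hi] := excess_gap_lt gpq vqc vpqc.
have [lo _] := excess_gap_lt gpq vpqc' vqc'.
(* The chain, omitting [D], is {p, q+1, c}, {p, q, q+1}, {p, q, c'}, {p+1, q, c'}: the excess never
   decreases along it, yet it starts at [low + 1] and ends at [low]. *)
have le1 := excessS_exchange cq v1 v2.
have le2 : excessS [:: q.+1, q, p & D] <= excessS [:: c', q, p & D].
  by apply: excessS_exchange v3 v4; case/andP: qc.
have le3 := excessS_exchange (ltnSn p) v5 v6.
have := le_trans (le_trans le1 _) (le_trans le2 (le_trans _ le3)).
rewrite -(swap p q.+1 c) hi (swap q) (swap c') (flip p.+1) lo.
by move=> /(_ (lexx _) (lexx _)); clear; lia.
Qed.

Lemma gap_inner_le p q :
  (p.+1 < q)%N || (q.+1 < p)%N -> (p.+1 < k)%N -> (0 < q)%N -> (q.+2 < k)%N ->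
  (p == 0%N) ==> (2 < q)%N -> (p.+2 == k) ==> (q + 4 < k)%N -> gap q <= gap p.
Proof.
move=> pq pk q0 qk p0 pk2.
(* The extreme indices 0 and [k - 1] serve as [c] and [c'] unless they lie in {p, p+1}; then the
   nearest index outside this pair is used. *)
apply: (gap_le (c := if p == 0%N then 2%N else 0%N)
               (c' := if p.+2 == k then (k - 3)%N else (k - 1)%N)).
all: rewrite ?inE; clear -pq pk q0 qk p0 pk2.
all: move: p0 pk2; case: (p =P 0%N) => ?; case: (p.+2 =P k) => ?.
all: rewrite /=; lia.
Qed.

Lemma gap_inner p : (0 < p)%N -> (p.+2 < k)%N -> gap p = gap 1%N.
Proof.
have eq_gap x y : (x.+1 < y)%N -> (0 < x)%N -> (y.+2 < k)%N -> gap y = gap x.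
  move=> xy x0 yk; apply/le_anti/andP; split; apply: gap_inner_le;
    by clear -xy x0 yk; lia.
move=> p0 pk; have [p3|] := leqP 3 p; first exact: eq_gap.
case: p p0 pk => [|[|[|]]] // _ _ _.
have k7 : (7 < k)%N by clear -k_ge h_ge3; lia.
(* Gaps 1 and 2 are adjacent, so they are compared through gap 5. *)
by rewrite -(@eq_gap 2%N 5%N) // (@eq_gap 1%N 5%N).
Qed.

Lemma gap_first_ge : gap 1 <= gap 0.
Proof.
(* Gap 3 stands in for gap 1, since for [p = 0] the comparison requires [2 < q]. *)
by rewrite -(@gap_inner 3%N) ?gap_inner_le //; clear -k_ge h_ge3; lia.
Qed.

Lemma gap_last_ge : gap 1 <= gap (k - 2).
Proof.
by rewrite -(@gap_inner 3%N) ?gap_inner_le //; clear -k_ge h_ge3; lia.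
Qed.

(** The set {1, 4, k-2} with padding would have excess [low + 1] by comparison with {0, 5, k-2}, and
    [low] by comparison with {1, 3, k-1}. *)
Lemma gap_not_both_ends : gap 1 < gap 0 -> gap 1 < gap (k - 2) -> False.
Proof.
move=> lt0 ltk.
have [|D vD] := @extend_index_set h k 3
    [:: 0; 1; 3; 4; 5; k - 2; (k - 2).+1]%N h_ge3.
  by clear -k_ge; rewrite /=; lia.
have v x y z : uniq [:: x; y; z] -> all (fun i => i < k)%N [:: x; y; z] ->
    all (mem [:: 0; 1; 3; 4; 5; k - 2; (k - 2).+1]%N) [:: x; y; z] ->
    index_set h k [:: x, y, z & D] by exact: vD.
have v1 : index_set h k [:: 5, 0, (k - 2)%N & D].
  by apply: v; rewrite /= ?inE ?eqxx ?orbT //; clear -k_ge h_ge3; lia.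
have v2 : index_set h k [:: 4, 1, (k - 2)%N & D].
  by apply: v; rewrite /= ?inE ?eqxx ?orbT //; clear -k_ge h_ge3; lia.
have v3 : index_set h k [:: 4, (k - 2)%N, 1 & D].
  by apply: v; rewrite /= ?inE ?eqxx ?orbT //; clear -k_ge h_ge3; lia.
have v4 : index_set h k [:: 3, (k - 2).+1, 1 & D].
  by apply: v; rewrite /= ?inE ?eqxx ?orbT //; clear -k_ge h_ge3; lia.
have lt40 : gap 4 < gap 0 by rewrite gap_inner //; clear -k_ge h_ge3; lia.
have lt3k : gap 3 < gap (k - 2) by rewrite gap_inner //; clear -k_ge h_ge3; lia.
have [_ hi] := excess_gap_lt lt40 v1 v2.
have [lo _] := excess_gap_lt lt3k v3 v4.
have := hi; have -> : excessS [:: 4, 1, (k - 2)%N & D] =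
    excessS [:: 4, (k - 2)%N, 1 & D].
  by apply: perm_excess; apply/permP => P /=; clear; lia.
by rewrite lo; clear; lia.
Qed.

(** The difference in index sum cancels the difference in excess, so both sums have equally many
    elements of [S] below them. *)
Lemma excess_low_high_eq B B' : index_set h k B -> index_set h k B' ->
  sumn B = (sumn B').+1 -> excessS B = low -> excessS B' = low + 1 ->
  nth_sum a B = nth_sum a B'.
Proof.
move=> vB vB' sBB' lo hi; apply: (@below_inj S); rewrite ?sum_in //.
by move: lo hi; rewrite /excessS /excess sBB'; clear; lia.
Qed.

(** With padding, {0, 5} has excess [low] and {1, 3} has [low + 1], so their sums agree and a_1 -
    a_0 = a_5 - a_3, which is two inner gaps. *)
Lemma gap_first_double : gap 1 < gap 0 -> gap 0 = 2 * gap 1.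
Proof.
move=> lt0; have h2 : (2 <= h)%N by exact: ltnW.
have [|D vD] := @extend_index_set h k 2 [:: 0; 1; 3; 4; 5]%N h2.
  by clear -k_ge; rewrite /=; lia.
have v x y : uniq [:: x; y] -> all (fun i => i < k)%N [:: x; y] ->
    all (mem [:: 0; 1; 3; 4; 5]%N) [:: x; y] ->
    index_set h k [:: x, y & D] by exact: vD.
have k6 : (6 < k)%N by clear -k_ge; lia.
have v1 : index_set h k [:: 5, 0 & D] by apply: v; rewrite //=; clear -k6; lia.
have v2 : index_set h k [:: 4, 1 & D] by apply: v; rewrite //=; clear -k6; lia.
have v3 : index_set h k [:: 4, 0 & D] by apply: v; rewrite //=; clear -k6; lia.
have v4 : index_set h k [:: 3, 1 & D] by apply: v; rewrite //=; clear -k6; lia.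
have g4 : gap 4 = gap 1 by apply: gap_inner; clear -k6; lia.
have g3 : gap 3 = gap 1 by apply: gap_inner; clear -k6; lia.
have lt4 : gap 4 < gap 0 by rewrite g4.
have lt3 : gap 3 < gap 0 by rewrite g3.
have [lo _] := excess_gap_lt lt4 v1 v2.
have [_ hi] := excess_gap_lt lt3 v3 v4.
have := excess_low_high_eq v1 v4 erefl lo hi.
have : a 5 - a 4 = a 2 - a 1 by exact: g4.
have : a 4 - a 3 = a 2 - a 1 by exact: g3.
by rewrite !nth_sum_cons /gap; lra.
Qed.

(** The same argument at the other end: {5, k-2} has excess [low] and {3, k-1} has [low + 1]. *)
Lemma gap_last_double : gap 1 < gap (k - 2) -> gap (k - 2) = 2 * gap 1.
Proof.
move=> ltk; have h2 : (2 <= h)%N by exact: ltnW.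
have k9 : (9 < k)%N by clear -k_ge h_ge3; lia.
have [|D vD] := @extend_index_set h k 2
    [:: 3; 4; 5; k - 2; (k - 2).+1]%N h2.
  by clear -k_ge; rewrite /=; lia.
have v x y : uniq [:: x; y] -> all (fun i => i < k)%N [:: x; y] ->
    all (mem [:: 3; 4; 5; k - 2; (k - 2).+1]%N) [:: x; y] ->
    index_set h k [:: x, y & D] by exact: vD.
have v1 : index_set h k [:: 4, (k - 2)%N & D].
  by apply: v; rewrite /= ?inE ?eqxx ?orbT //; clear -k9; lia.
have v2 : index_set h k [:: 3, (k - 2).+1 & D].
  by apply: v; rewrite /= ?inE ?eqxx ?orbT //; clear -k9; lia.
have v3 : index_set h k [:: 5, (k - 2)%N & D].
  by apply: v; rewrite /= ?inE ?eqxx ?orbT //; clear -k9; lia.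
have v4 : index_set h k [:: 4, (k - 2).+1 & D].
  by apply: v; rewrite /= ?inE ?eqxx ?orbT //; clear -k9; lia.
have g4 : gap 4 = gap 1 by apply: gap_inner; clear -k9; lia.
have g3 : gap 3 = gap 1 by apply: gap_inner; clear -k9; lia.
have lt3 : gap 3 < gap (k - 2) by rewrite g3.
have lt4 : gap 4 < gap (k - 2) by rewrite g4.
have [_ hi] := excess_gap_lt lt3 v1 v2.
have [lo _] := excess_gap_lt lt4 v3 v4.
have eq1 : sumn [:: 5, (k - 2)%N & D] = (sumn [:: 3, (k - 2).+1 & D]).+1.
  by rewrite /=; clear; lia.
have := excess_low_high_eq v3 v2 eq1 lo hi.
have : a 5 - a 4 = a 2 - a 1 by exact: g4.
have : a 4 - a 3 = a 2 - a 1 by exact: g3.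
by rewrite !nth_sum_cons /gap; lra.
Qed.

(** In an arithmetic progression a sum depends only on its index sum, which takes at most h(k-h)+1
    values, one fewer than [S] has elements. *)
Lemma gap_not_constant c :
  ~ (forall i, (i < k)%N -> a i = a 0 + c * i%:Z).
Proof.
move=> aE; have hk : (h <= k)%N by clear -k_ge; lia.
pose T := [seq a 0 * h%:Z + c * i%:Z |
            i <- iota (sumn (iota 0 h)) (h * (k - h)).+1].
have : (size S <= size T)%N.
  apply: uniq_leq_size (fset_uniq S) _ => x /in_sum[B vB ->].
  have [_ /eqP sB kB] := and3P vB; rewrite (nth_sum_arith aE) // sB.
  apply/mapP; exists (sumn B) => //; rewrite mem_iota.
  by have := sumn_bounds hk vB; clear; lia.
by rewrite size_map size_iota card_S addn2 ltnn.
Qed.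

(** The alternatives lead to the missing points 1 and k-1 respectively, once [c = 1] is known. *)
Lemma gap_structure : exists2 c, 0 < c &
  [/\ gap 0 = 2 * c & forall i, (0 < i)%N -> (i.+1 < k)%N -> gap i = c] \/
  [/\ gap (k - 2) = 2 * c & forall i, (i.+2 < k)%N -> gap i = c].
Proof.
exists (gap 1); first by rewrite subr_gt0 a_lt //; clear -k_ge; lia.
have := gap_first_ge; rewrite le_eqVlt => /orP[/eqP e0|lt0].
  have := gap_last_ge; rewrite le_eqVlt => /orP[/eqP ek|ltk].
    case: (@gap_not_constant (gap 1)) => i; elim: i => [|i IH] ik.
      by rewrite mulr0 addr0.
    have gi : gap i = gap 1.
      have [-> //|i0] := posnP i.
      have [ei|ei] := eqVneq i (k - 2)%N; first by rewrite ei.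
      by apply: gap_inner => //; clear -ik ei; lia.
    rewrite -[LHS](subrK (a i)) -/(gap i) gi IH ?(ltnW ik) // intS.
    by ring.
  right; split; first exact: gap_last_double.
  move=> i ik; have [-> //|i0] := posnP i; exact: gap_inner.
left; split; first exact: gap_first_double.
move=> i i0 ik; have [ei|ei] := eqVneq i (k - 2)%N.
  have := gap_last_ge; rewrite -ei le_eqVlt => /orP[/eqP //|].
  by rewrite ei => /(gap_not_both_ends lt0).
by apply: gap_inner => //; clear -ik ei; lia.
Qed.

End Gaps.

(** * Passing between $A$ and its increasing enumeration *)

Section Enumeration.

Variable A : {fset int}.

Definition enum_nth (i : nat) : int := nth 0 (sort <=%O A) i.

Lemma enum_nth_lt i j : (i < j < #|` A|)%N -> enum_nth i < enum_nth j.
Proof.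
move=> /andP[ij jA]; have sA : size (sort <=%O A) = #|` A| by rewrite size_sort.
have lt_sA : sorted <%O (sort <=%O A).
  by apply: etrans (sort_lt_sorted _) (fset_uniq A).
rewrite /enum_nth (lt_sorted_ltn_nth 0 lt_sA) // inE sA //.
exact: ltn_trans jA.
Qed.

Lemma enum_nth_in i : (i < #|` A|)%N -> enum_nth i \in A.
Proof.
by move=> iA; rewrite -(mem_sort <=%O) mem_nth // size_sort.
Qed.

Lemma enum_nthP x : x \in A -> exists2 i, (i < #|` A|)%N & x = enum_nth i.
Proof.
rewrite -(mem_sort <=%O) => /(nthP 0)[i]; rewrite size_sort => iA <-.
by exists i.
Qed.

Lemma enum_nth_inj i j : (i < #|` A|)%N -> (j < #|` A|)%N ->
  enum_nth i = enum_nth j -> i = j.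
Proof.
move=> iA jA /eqP e; apply/eqP; move: e.
by rewrite /enum_nth nth_uniq ?size_sort // sort_uniq fset_uniq.
Qed.

(** Together with [in_nth_sum], this identifies $h^{\wedge}A$ with the sums over index sets, as the
    analysis of gaps assumes. *)
Lemma nth_sum_in h B : index_set h #|` A| B ->
  nth_sum enum_nth B \in restricted_sumset h A.
Proof.
case/and3P => uB /eqP sB /allP kB.
have uM : uniq [seq enum_nth i | i <- B].
  by rewrite map_inj_in_uniq // => i j /kB ik /kB jk; apply: enum_nth_inj.
apply/restricted_sumsetP; exists [fset x in [seq enum_nth i | i <- B]].
  apply/andP; split.
    apply/fsubsetP => x; rewrite !inE => /mapP[i /kB iA ->].
    exact: enum_nth_in.
  by rewrite card_fseq undup_id // size_map sB.
rewrite /nth_sum -(big_map enum_nth xpredT (fun x => x)); apply: perm_big.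
by apply: uniq_perm => // [|x]; rewrite ?fset_uniq ?inE.
Qed.

Lemma in_nth_sum h x : x \in restricted_sumset h A ->
  exists2 B, index_set h #|` A| B & x = nth_sum enum_nth B.
Proof.
case/restricted_sumsetP => C /andP[/fsubsetP CA /eqP sC] ->.
pose s := sort <=%O A.
have Cs y : y \in C -> y \in s by move/CA; rewrite mem_sort.
exists [seq index y s | y <- C].
  rewrite /index_set size_map sC eqxx map_inj_in_uniq ?fset_uniq /=.
    apply/allP => i /mapP[y /Cs ys ->]; by rewrite -(size_sort <=%O) index_mem.
  by move=> y z /Cs ys /Cs zs; apply: index_inj.
rewrite /nth_sum big_map; apply: eq_big_seq => y /Cs ys.
by rewrite /enum_nth nth_index.
Qed.

End Enumeration.

Lemma enum_nth0 (A : {fset int}) : 0 \in A -> (forall x, x \in A -> 0 <= x) ->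
  enum_nth A 0 = 0.
Proof.
move=> A0 Age0; have [i iA ei] := enum_nthP A0.
apply/le_anti; rewrite Age0 ?enum_nth_in ?(leq_trans _ iA) // andbT [leRHS]ei.
have [-> //|i0] := posnP i; apply/ltW/enum_nth_lt; by rewrite i0.
Qed.

(** * Recovering $A$ from its gaps *)

Unset Implicit Arguments.

Theorem theorem1p10 (h k : nat) (A : {fset int})
    (hh : (3 <= h)%N) (hk : (3 * h + 1 <= k)%N)
    (cardA : #|` A| = k)
    (minA : 0 \in A /\ (forall a : int, a \in A -> 0 <= a))
    (gcdA : set_gcd A = 1)
    (card_hA : (#|` restricted_sumset h A|)%:Z = h%:Z * k%:Z - h%:Z ^+ 2 + 2) :
  exists2 x : int, x \in [fset 1; k%:Z - 1] & A = zinterval 0 k%:Z `\ x.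
Proof.
have [A0 Age0] := minA; pose a := enum_nth A.
have a0 : a 0%N = 0 by exact: enum_nth0.
have k7 : (h + 7 <= k)%N by clear -hh hk; lia.
have a_lt i j : (i < j < k)%N -> a i < a j.
  by rewrite -cardA; apply: enum_nth_lt.
have sum_in B : index_set h k B -> nth_sum a B \in restricted_sumset h A.
  by rewrite -cardA; apply: nth_sum_in.
have in_sum x : x \in restricted_sumset h A ->
    exists2 B, index_set h k B & x = nth_sum a B.
  by rewrite -cardA; apply: in_nth_sum.
have card_S : #|` restricted_sumset h A| = (h * (k - h) + 2)%N.
  by move: card_hA k7; clear; nia.
have inA x : reflect (exists2 i, (i < k)%N & x = a i) (x \in A).
  apply: (iffP idP) => [|[i ik ->]].
    by rewrite -cardA; apply: enum_nthP.
  by apply: enum_nth_in; rewrite cardA.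
have [c c0 gapsc] := gap_structure hh k7 a_lt sum_in in_sum card_S.
(* As [a 0 = 0], a common divisor of the gaps divides every element of [A], hence the gcd. *)
have c1 : (forall i, (i.+1 < k)%N -> (c %| a i.+1 - a i)%Z) -> c = 1.
  move=> cgap; have : (c %| set_gcd A)%Z.
    rewrite dvdz_set_gcd; apply/allP => _ /inA[i ik ->].
    elim: i ik => [|i IH] ik; first by rewrite a0 dvdz0.
    by rewrite -(subrK (a i) (a i.+1)) rpredD ?cgap ?IH // ltnW.
  by rewrite gcdA dvdz1; move: c0; clear; lia.
have mem_nth_eq x i : (i < k)%N -> x = a i -> x \in A.
  by move=> ik ->; apply/inA; exists i.
case: gapsc => -[end2 rest].
  have {}c1 : c = 1.
    apply: c1 => -[|i] ik; last by rewrite rest.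
    by rewrite end2 dvdz_mull.
  (* A first gap of 2 followed by gaps of 1 gives 0, 2, 3, ..., k. *)
  have aE i : (0 < i < k)%N -> a i = i%:Z + 1.
    case: i => // i; elim: i => [|i IH] ik.
      by move: end2; rewrite a0 c1 subr0.
    have := rest i.+1 isT ik; rewrite c1 => /eqP; rewrite subr_eq => /eqP ->.
    by rewrite IH ?(ltnW ik) // addrA -intS.
  exists 1; first by rewrite !inE eqxx.
  apply/fsetP => x; rewrite in_fsetD1 mem_zinterval; apply/idP/idP.
    case/inA => -[|i] ik ->; first by rewrite a0; clear; lia.
    by rewrite aE //; move: ik; clear; lia.
  move=> xk; have [->|x0] := eqVneq x 0; first exact: A0.
  by apply: (mem_nth_eq x `|x - 1|%N); rewrite ?aE; move: xk x0; clear; lia.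
have {}c1 : c = 1.
  apply: c1 => i ik; have [ei|ei] := eqVneq i (k - 2)%N.
    by rewrite ei end2 dvdz_mull.
  by rewrite rest //; move: ei ik; clear; lia.
(* Here the elements are 0, 1, ..., k-2, and the last gap of 2 leads to k. *)
have aE i : (i.+1 < k)%N -> a i = i%:Z.
  elim: i => [|i IH] ik; first by rewrite a0.
  have := rest i ik; rewrite c1 => /eqP; rewrite subr_eq => /eqP ->.
  by rewrite IH ?(ltnW ik) // -intS.
have aK : a (k - 1)%N = k%:Z.
  have k2 : (1 < k)%N by move: k7; clear; lia.
  have -> : (k - 1 = (k - 2).+1)%N by move: k2; clear; lia.
  have ek : a (k - 2)%N = (k - 2)%N%:Z by apply: aE; move: k2; clear; lia.
  by move: end2; rewrite c1 ek; move: (a _) k2 => y; clear; lia.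
exists (k%:Z - 1); first by rewrite !inE eqxx orbT.
apply/fsetP => x; rewrite in_fsetD1 mem_zinterval; apply/idP/idP.
  case/inA => i ik ->; have [->|ei] := eqVneq i (k - 1)%N.
    by rewrite aK; clear; lia.
  have ik1 : (i.+1 < k)%N by move: ei ik; clear; lia.
  by rewrite aE //; move: ik1; clear; lia.
move=> xk; have [->|x0] := eqVneq x k%:Z.
  by apply: (mem_nth_eq _ (k - 1)%N); rewrite ?aK //; move: k7; clear; lia.
by apply: (mem_nth_eq x `|x|%N); rewrite ?aE; move: xk x0; clear; lia.
Qed.
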